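(* Let $\mathcal{A}=(\Sigma,Q,F,\Delta)$ be a $T$-shaped tree automaton. Then the polytope $P(\mathcal{A})$ has an extended formulation with $O(|Q|+|\Delta|)$ extension variables and $O(|Q|+|T|\cdot|\Sigma|)$ inequalities, where $|T|$ is the number of nodes of $T$.
   Context: An addressed tree $T$ is a rooted tree with node set $N(T)$, root $r$, in which the children of each node are numbered $1,\dots,s$. Let $\Sigma$ be a finite alphabet. A $T$-shaped term over $\Sigma$ is a map $\tau:N(T)\to\Sigma$. A $T$-shaped tree automaton is a tuple $\mathcal{A}=(\Sigma,Q,F,\Delta)$ where $Q$ is a finite set of states partitioned into cells $\{Q_u\}_{u\in N(T)}$, $F\subseteq Q_r$ is the set of final states, and $\Delta$ is a set of transitions partitioned into $\{\Delta_u\}_{u\in N(T)}$ with $\Delta_u\subseteq Q_{u_1}\times\dots\times Q_{u_s}\times\Sigma\times Q_u$, where $u_1,\dots,u_s$ are the children of $u$ in order. A trace for a term $\tau$ is a map $\rho:N(T)\to Q$ with $(\rho(u_1),\dots,\rho(u_s),\tau(u),\rho(u))\in\Delta_u$ for all $u$; it is accepting if $\rho(r)\in F$. $\mathcal{L}(\mathcal{A})$ is the set of $T$-shaped terms with an accepting trace. For a term $\tau$, $\hat\tau$ is the 0/1 vector over variables $\{x_{u,a}:u\in N(T),a\in\Sigma\}$ with $\hat\tau(x_{u,a})=1$ iff $\tau(u)=a$. $P(\mathcal{A})=\mathrm{conv}\{\hat\tau:\tau\in\mathcal{L}(\mathcal{A})\}$. A polytope $P'$ is an extended formulation of $P$ if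 $P$ is a projection of $P'$.
   Formalization: The sign conditions y ≥ 0 on the extension variables are not counted among the O(|Q|+|T|·|Σ|) inequalities (with them counted the bound fails, e.g. for edge polytopes of projective-plane incidence graphs), and the alphabet Σ is assumed nonempty. *)

(* Defs.v *)
From HB Require Import structures.
From mathcomp Require Import all_boot all_order all_algebra.

Set Implicit Arguments.
Unset Strict Implicit.
Unset Printing Implicit Defensive.

Import Order.TTheory GRing.Theory Num.Theory.
Local Open Scope ring_scope.

(* The i-th child of u is the i-th entry of [children u].  The last four fields
   say that the parent/child relation is a tree rooted at [root]. *)
Record addressed_tree := AddressedTree {
  node :> finType;
  root : node;
  children : node -> seq node;
  children_uniq : forall u, uniq (children u);
  parent_unique : forall u u' v,
    v \in children u -> v \in children u' -> u = u';
  root_orphan : forall u, root \notin children u;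
  root_connect : forall v, connect (fun u w => w \in children u) root v
}.

Definition term (T : addressed_tree) (Sigma : finType) := {ffun T -> Sigma}.

(* The partition of Q is given by the map [cell] sending a state to the node
   whose cell contains it.  A transition at u is a triple
   ((q_1, ..., q_s), a, q). *)
Record tree_automaton (T : addressed_tree) (Sigma : finType) := TreeAutomaton {
  state : finType;
  cell : state -> T;
  final : {set state};
  trans : forall u : T,
    {set ((size (children u)).-tuple state * Sigma * state)%type};
  final_root : forall q, q \in final -> cell q = root T;
  trans_cell : forall u t, t \in trans u ->
    map cell t.1.1 = children u /\ cell t.2 = u
}.

(* The sets [trans u] are pairwise disjoint as sets of transitions, the target
   of each transition at u being in the cell of u. *)
Definition ntrans (T : addressed_tree) (Sigma : finType)
    (A : tree_automaton T Sigma) : nat :=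
  (\sum_(u : T) #|trans A u|)%N.

Definition is_trace (T : addressed_tree) (Sigma : finType)
    (A : tree_automaton T Sigma) (tau : term T Sigma)
    (rho : {ffun T -> state A}) : Prop :=
  forall u : T,
    (map_tuple rho (in_tuple (children u)), tau u, rho u) \in trans A u.

Definition language (T : addressed_tree) (Sigma : finType)
    (A : tree_automaton T Sigma) (tau : term T Sigma) : Prop :=
  exists rho : {ffun T -> state A},
    is_trace tau rho /\ rho (root T) \in final A.

Definition term_vector (R : realFieldType) (T : addressed_tree)
    (Sigma : finType) (tau : term T Sigma) : {ffun T * Sigma -> R} :=
  [ffun v => (tau v.1 == v.2)%:R].

Definition convex_hull (R : realFieldType) (X : finType)
    (S : {ffun X -> R} -> Prop) (x : {ffun X -> R}) : Prop :=
  exists (n : nat) (p : 'I_n -> {ffun X -> R}) (c : 'I_n -> R),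
    [/\ forall i, S (p i), forall i, 0 <= c i, \sum_i c i = 1
      & forall v, x v = \sum_i c i * p i v].

Definition automaton_polytope (R : realFieldType) (T : addressed_tree)
    (Sigma : finType) (A : tree_automaton T Sigma) :
    {ffun T * Sigma -> R} -> Prop :=
  convex_hull (fun x : {ffun T * Sigma -> R} =>
    exists tau : term T Sigma, language A tau /\ x = term_vector R tau).

(* A system of [nineq] linear inequalities  C x + D y <= b  in the original
   variables x, indexed by X, and [nvar] nonnegative extension variables y.
   As usual for linear programs, the sign conditions y >= 0 are not counted
   among the inequalities; an equation counts as two inequalities, and the
   variables x are free. *)
Record linear_system (R : realFieldType) (X : finType) := LinearSystem {
  nvar : nat;
  nineq : nat;
  coef_orig : 'I_nineq -> X -> R;
  coef_ext : 'I_nineq -> 'I_nvar -> R;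
  rhs : 'I_nineq -> R
}.

Definition solution (R : realFieldType) (X : finType) (S : linear_system R X)
    (x : {ffun X -> R}) (y : {ffun 'I_(nvar S) -> R}) : Prop :=
  (forall i : 'I_(nineq S),
     \sum_v coef_orig i v * x v + \sum_j coef_ext i j * y j <= rhs i)
  /\ (forall j, 0 <= y j).

Definition bounded_system (R : realFieldType) (X : finType)
    (S : linear_system R X) : Prop :=
  exists M : R, forall (x : {ffun X -> R}) (y : {ffun 'I_(nvar S) -> R}),
    solution x y -> (forall v, `|x v| <= M) /\ (forall j, `|y j| <= M).

Definition extended_formulation (R : realFieldType) (X : finType)
    (S : linear_system R X) (P : {ffun X -> R} -> Prop) : Prop :=
  bounded_system S /\
  (forall x, P x <-> exists y : {ffun 'I_(nvar S) -> R}, solution x y).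

(* Main.v *)
Require Import Defs.
From mathcomp Require Import all_boot all_order all_algebra.
(* Again, since MathComp shadows [root] and [root_connect]. *)
Import Defs.

Set Implicit Arguments.
Unset Strict Implicit.

(** Give every transition [d] a nonnegative weight [z d] and require, at every
    non-final state, that the weight of the transitions entering it (with that
    target) equal the weight of the transitions using it as a source; the
    transitions with a final target have total weight 1.  Accepting runs are
    0/1 solutions.  Conversely, from a transition of positive weight one climbs
    to the root and then descends to every leaf along transitions of positive
    weight, by conservation; subtracting the run so obtained, scaled by its
    smallest weight, shrinks the support of [z].  Hence every solution is a
    convex combination of accepting runs. *)

(** * Paths from the root and parents in an addressed tree *)

Section AddressedTree.

Variable T : addressed_tree.

Definition child : rel T := fun u v => v \in children u.

Lemma root_pathP (v : T) :
  exists p, path child (root T) p && (last (root T) p == v).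
Proof.
have /connectP[p pp ->] := root_connect v.
by exists p; rewrite pp eqxx.
Qed.

(** Peel off last nodes: uniqueness of parents makes the two paths agree one step earlier, and the
    root having no parent excludes different lengths. *)
Lemma root_path_inj (p q : seq T) :
  path child (root T) p -> path child (root T) q ->
  last (root T) p = last (root T) q -> p = q.
Proof.
elim/last_ind: p q => [|p v IHp] q.
  case/lastP: q => [//|q w] _; rewrite rcons_path last_rcons /= => /andP[_ +] e.
  by rewrite /child -e (negbTE (root_orphan _)).
rewrite rcons_path last_rcons => /andP[pp pv].
case/lastP: q => [_ /= e|q w].
  by move: pv; rewrite /child e (negbTE (root_orphan _)).
rewrite rcons_path last_rcons => /andP[qq qw] e; rewrite -{w}e in qw *.
by rewrite (IHp q) // (parent_unique pv qw).
Qed.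

Lemma parent_exists (v : T) : v != root T -> exists u, v \in children u.
Proof.
have [p] := root_pathP v; case/lastP: p => [|p w].
  by move=> /= /eqP->; rewrite eqxx.
rewrite rcons_path last_rcons => /andP[/andP[_ pw] /eqP <-] _.
by exists (last (root T) p).
Qed.

End AddressedTree.

(** * Systems of linear equations as systems of inequalities *)

Section EquationSystem.

Import Order.TTheory GRing.Theory Num.Theory.
Local Open Scope ring_scope.

Variables (R : realFieldType) (X E J : finType).
Variables (C : E -> X -> R) (D : E -> J -> R) (b : E -> R).

(** Each equation gives two inequalities; the boolean in the index selects the sign, [true] giving
    the reversed one. *)
Definition equation_system : linear_system R X :=
  @LinearSystem R X #|J| #|{: bool * E}|
    (fun i x => (-1) ^+ (enum_val i).1 * C (enum_val i).2 x)
    (fun i j => (-1) ^+ (enum_val i).1 * D (enum_val i).2 (enum_val j))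
    (fun i => (-1) ^+ (enum_val i).1 * b (enum_val i).2).

Lemma equation_systemP (x : {ffun X -> R})
    (y : {ffun 'I_(nvar equation_system) -> R}) :
  solution x y <->
  (forall e, \sum_v C e v * x v + \sum_j D e j * y (enum_rank j) = b e) /\
  (forall j, 0 <= y (enum_rank j)).
Proof.
have lhsE (i : 'I_#|{: bool * E}|) :
    \sum_v coef_orig (l := equation_system) i v * x v
      + \sum_j coef_ext (l := equation_system) i j * y j
    = (-1) ^+ (enum_val i).1 * (\sum_v C (enum_val i).2 v * x v
        + \sum_j D (enum_val i).2 j * y (enum_rank j)).
  rewrite mulrDr !mulr_sumr; congr (_ + _).
    by apply: eq_bigr => v _; rewrite mulrA.
  rewrite [RHS](reindex_onto (@enum_val J J) (@enum_rank J)) /=; last first.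
    by move=> j _; rewrite enum_rankK.
  apply: eq_big => [j|j _]; first by rewrite enum_valK eqxx.
  by rewrite enum_valK mulrA.
split=> [[ineq y_ge0]|[eqs y_ge0]].
  split=> [e|j]; last exact: y_ge0.
  apply/eqP; rewrite eq_le; apply/andP; split.
    have := ineq (enum_rank (false, e)).
    by rewrite lhsE /= enum_rankK /= !expr0 !mul1r.
  have := ineq (enum_rank (true, e)).
  by rewrite lhsE /= enum_rankK /= !expr1 !mulN1r lerN2.
split=> [i|j]; first by rewrite lhsE eqs.
by rewrite -[j]enum_valK.
Qed.

End EquationSystem.

(** * Transitions and accepting runs *)

Section Flow.

Import Order.TTheory GRing.Theory Num.Theory.
Local Open Scope ring_scope.

Variables (T : addressed_tree) (Sigma : finType) (A : tree_automaton T Sigma).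

Definition transition : finType :=
  {u : T & {t : (size (children u)).-tuple (state A) * Sigma * state A
          | t \in trans A u}}.

Definition sources (d : transition) : seq (state A) := (val (tagged d)).1.1.
Definition label (d : transition) : Sigma := (val (tagged d)).1.2.
Definition target (d : transition) : state A := (val (tagged d)).2.

Lemma card_transition : #|transition| = ntrans A.
Proof.
rewrite card_tagged sumnE big_map big_enum; apply: eq_bigr => u _.
by rewrite card_sig; apply: eq_card.
Qed.

Lemma map_cell_sources (d : transition) :
  map (@cell _ _ A) (sources d) = children (tag d).
Proof. by have [] := trans_cell (valP (tagged d)). Qed.

Lemma cell_target (d : transition) : cell (target d) = tag d.
Proof. by have [] := trans_cell (valP (tagged d)). Qed.

Lemma cell_source (d : transition) q :
  q \in sources d -> cell q \in children (tag d).
Proof. by move=> qd; rewrite -map_cell_sources map_f. Qed.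

Lemma size_sources (d : transition) : size (sources d) = size (children (tag d)).
Proof. by rewrite -map_cell_sources size_map. Qed.

(** An accepting trace recorded by its transitions instead of its states. The predicate is boolean
    on a finite type, so sums can range over all runs. *)
Definition is_run (del : {ffun T -> transition}) : bool :=
  [forall u, (tag (del u) == u)
     && (sources (del u) == [seq target (del v) | v <- children u])]
  && (target (del (root T)) \in final A).

Lemma run_tag del u : is_run del -> tag (del u) = u.
Proof. by case/andP=> /forallP/(_ u)/andP[/eqP]. Qed.

Lemma run_sources del u : is_run del ->
  sources (del u) = [seq target (del v) | v <- children u].
Proof. by case/andP=> /forallP/(_ u)/andP[_ /eqP]. Qed.

Lemma run_cell del u : is_run del -> cell (target (del u)) = u.
Proof. by move=> run; rewrite cell_target run_tag. Qed.

Definition run_term (del : {ffun T -> transition}) : term T Sigma :=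
  [ffun u => label (del u)].

Lemma run_language del : is_run del -> language A (run_term del).
Proof.
move=> run; exists [ffun u => target (del u)]; split; last first.
  by rewrite ffunE; case/andP: run.
move=> u; have := run_sources u run; have := run_tag u run.
rewrite !ffunE /sources /label /target.
(* The tag is replaced by [u] so that the stored source tuple [s] has the length that [trans A u]
   expects. *)
case: (del u) => v [[[s a] q] t_in] /= ev; rewrite {v}ev in s t_in *.
move=> es; suff -> : map_tuple [ffun v => target (del v)] (in_tuple (children u)) = s
  by [].
by apply: val_inj; rewrite /= es; apply: eq_map => v; rewrite ffunE.
Qed.

Lemma language_run tau : language A tau ->
  exists2 del, is_run del & run_term del = tau.
Proof.
case=> rho [tr fin].
exists [ffun u => Tagged (fun u => {t | t \in trans A u})
                    (exist (fun t => t \in trans A u) _ (tr u))].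
  apply/andP; split; last by rewrite ffunE.
  apply/forallP=> u; rewrite !ffunE eqxx /=.
  by apply/eqP/eq_map=> v; rewrite ffunE.
by apply/ffunP=> u; rewrite !ffunE.
Qed.

(** * Runs as conserved 0/1 weights on transitions *)

Variable R : realFieldType.

Implicit Types (z : transition -> R) (del : {ffun T -> transition}).

Definition run_weight del (d : transition) : R := (d == del (tag d))%:R.

Lemma sum_run_weight del (P : pred transition) : is_run del ->
  \sum_(d | P d) run_weight del d = \sum_u (P (del u))%:R.
Proof.
move=> run; rewrite (partition_big (fun d => tag d) predT) //=.
apply: eq_bigr => u _; rewrite big_mkcond (bigD1 (del u)) //= big1 ?addr0.
  by rewrite /run_weight run_tag // !eqxx andbT; case: (P _).
move=> d d_neq; case: ifP => // /andP[_ /eqP td].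
by rewrite /run_weight td (negbTE d_neq).
Qed.

Definition conserved z : Prop := forall q, q \notin final A ->
  \sum_(d | target d == q) z d = \sum_(d | q \in sources d) z d.

(** Both sums are 1 if the run is in state [q] at the node [cell q], and 0 otherwise: then one
    transition enters [q], at [cell q], and one uses it, at the parent of [cell q]. *)
Lemma run_conserved del : is_run del -> conserved (run_weight del).
Proof.
move=> run q qF; rewrite !sum_run_weight //.
have targetE u : (target (del u) == q) = (target (del (cell q)) == q) && (u == cell q).
  apply/eqP/andP=> [<-|[/eqP eq /eqP->//]].
  by rewrite run_cell // !eqxx.
have sourceE u :
    (q \in sources (del u)) = (target (del (cell q)) == q) && (cell q \in children u).
  rewrite run_sources //; apply/mapP/andP=> [[v vu ->]|[/eqP eq qu]].
    by rewrite run_cell // eqxx.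
  by exists (cell q).
under eq_bigr do rewrite targetE.
under [RHS]eq_bigr do rewrite sourceE.
have [eq|_] := eqVneq; last by rewrite !big1.
(* The state of the run at the root is final, whereas [q] is not, so [cell q] has a parent. *)
have /parent_exists[u qu] : cell q != root T.
  apply: contraNneq qF => q_root; rewrite -eq q_root.
  by case/andP: run.
rewrite (bigD1 (cell q)) // [RHS](bigD1 u) //= eqxx qu !big1 // => v /negbTE neq.
  by apply/eqP; rewrite pnatr_eq0 eqb0; apply: contraFN neq => vq;
    rewrite (parent_unique qu vq).
by rewrite neq.
Qed.

Lemma run_final_weight del : is_run del ->
  \sum_(d | target d \in final A) run_weight del d = 1.
Proof.
move=> run; rewrite sum_run_weight // (bigD1 (root T)) //= big1 ?addr0.
  by case/andP: run => _ ->.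
move=> u u_neq; apply/eqP; rewrite pnatr_eq0 eqb0; apply: contra u_neq.
by move/final_root; rewrite run_cell // => ->.
Qed.

Lemma run_label_weight del u a : is_run del ->
  \sum_(d | (tag d == u) && (label d == a)) run_weight del d
  = term_vector R (run_term del) (u, a).
Proof.
move=> run; rewrite sum_run_weight // (bigD1 u) //= big1 ?addr0.
  by rewrite !ffunE run_tag // eqxx.
by move=> v /negbTE neq; rewrite run_tag // neq.
Qed.

(** * Extracting a run of positive weight *)

Section PositiveRun.

Variable z : transition -> R.
Hypothesis z_ge0 : forall d, 0 <= z d.
Hypothesis z_cons : conserved z.

Let live q := [exists d, (target d == q) && (0 < z d)].

(** A source lies in the cell of a child, hence off the root and not final; conservation turns its
    positive outflow into positive inflow. *)
Lemma live_source d q : 0 < z d -> q \in sources d -> live q.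
Proof.
move=> zd qd; apply/existsP.
have qF : q \notin final A.
  apply: contraTN (cell_source qd) => /final_root ->.
  exact: root_orphan.
apply: psumr_neq0P => //; rewrite z_cons // (bigD1 d) //=.
apply/eqP; rewrite gt_eqF // ltr_wpDr // sumr_ge0 //.
Qed.

(** Climb by induction on the root path of [cell q]: a live state that is not final has positive
    outflow, hence feeds a positive transition at the parent node. *)
Lemma live_final q : live q -> exists2 d, target d \in final A & 0 < z d.
Proof.
have [p /andP[pp /eqP]] := root_pathP (cell q).
elim/last_ind: p q pp => [|p v IHp] q pp /= cq /existsP[d /andP[/eqP dq zd]].
all: have [qF|qF] := boolP (q \in final A); first by exists d; rewrite ?dq.
all: have [//||d' /andP[qd' zd']] := @psumr_neq0P _ _ (fun d => q \in sources d) z.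
all: try by rewrite -z_cons // (bigD1 d) ?dq //=; apply/eqP;
  rewrite gt_eqF // ltr_wpDr // sumr_ge0.
(* For the empty path, [d'] would make the root a child, which closes that case. *)
all: have := cell_source qd'; rewrite -cq ?(negbTE (root_orphan _)) // last_rcons.
move: pp; rewrite rcons_path => /andP[pp pv] d'v.
apply: (IHp (target d')) => //; last by apply/existsP; exists d'; rewrite eqxx.
by rewrite cell_target (parent_unique d'v pv).
Qed.

Lemma positive_run d0 : 0 < z d0 ->
  exists2 del, is_run del & forall u, 0 < z (del u).
Proof.
move=> zd0; have [|d1 d1F zd1] := @live_final (target d0).
  by apply/existsP; exists d0; rewrite eqxx.
(* Descent: [next] chooses a positive transition into a live state, [step] reads off its source at
   the child [v], and [stateof] iterates this along a path from the root. The defaults [d1] and [q]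
   are never reached on live states and genuine children. *)
pose next q := odflt d1 [pick d | (target d == q) && (0 < z d)].
have nextP q : live q -> target (next q) = q /\ 0 < z (next q).
  rewrite /next; case: pickP => [d /andP[/eqP-> //]|none] /existsP[d].
  by rewrite none.
pose step q (v : T) := nth q (sources (next q)) (index v (children (cell q))).
pose stateof p := foldl step (target d1) p.
have tag_next q : live q -> tag (next q) = cell q.
  by case/nextP=> tq _; rewrite -cell_target tq.
have stateofP p : path (@child T) (root T) p ->
    cell (stateof p) = last (root T) p /\ live (stateof p).
  elim/last_ind: p => [_|p v IHp]; rewrite /stateof.
    split; first exact: final_root d1F.
    by apply/existsP; exists d1; rewrite eqxx.
  rewrite foldl_rcons rcons_path last_rcons -/(stateof p) => /andP[/IHp[cp lp] pv].
  have v_lt : (index v (children (cell (stateof p))) < size (sources (next (stateof p))))%N.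
    by rewrite size_sources tag_next // index_mem cp.
  split; last by apply: (@live_source (next (stateof p)));
    [case: (nextP _ lp)|exact: mem_nth].
  rewrite /step -(nth_map _ v) // map_cell_sources tag_next //.
  by rewrite nth_index // cp.
(* Root paths are unique, so the chosen path to a child extends the one to its parent; this makes
   the transitions chosen at neighbouring nodes fit together. *)
pose pth (v : T) := xchoose (root_pathP v).
have pthP v : path (@child T) (root T) (pth v) /\ last (root T) (pth v) = v.
  by have /andP[? /eqP] := xchooseP (root_pathP v).
have pth_child u v : v \in children u -> pth v = rcons (pth u) v.
  have [pu lu] := pthP u; have [pv lv] := pthP v => uv.
  by apply: root_path_inj; rewrite ?rcons_path ?last_rcons ?pu // lu.
have cell_pth u : cell (stateof (pth u)) = u.
  by have [pu lu] := pthP u; have [-> _] := stateofP _ pu.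
have live_pth u : live (stateof (pth u)).
  by have [pu lu] := pthP u; have [] := stateofP _ pu.
exists [ffun u => next (stateof (pth u))]; last first.
  by move=> u; rewrite ffunE; case: (nextP _ (live_pth u)).
apply/andP; split; last first.
  rewrite ffunE; have [-> _] := nextP _ (live_pth (root T)).
  suff -> : pth (root T) = [::] by [].
  by have [pr lr] := pthP (root T); apply: root_path_inj.
apply/forallP=> u; rewrite !ffunE tag_next // cell_pth eqxx /=.
have sz : size (sources (next (stateof (pth u)))) = size (children u).
  by rewrite size_sources tag_next // cell_pth.
apply/eqP/(@eq_from_nth _ (stateof (pth u))); first by rewrite size_map.
rewrite sz => i i_lt; rewrite (nth_map u) // ffunE.
have [-> _] := nextP _ (live_pth (nth u (children u) i)).
rewrite (pth_child u (nth u _ i)) ?mem_nth // /stateof foldl_rcons -/(stateof _) /step.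
by rewrite cell_pth index_uniq // children_uniq.
Qed.

End PositiveRun.

(** * Decomposition of conserved weights into runs *)

Lemma conserved_decomposition z :
  (forall d, 0 <= z d) -> conserved z ->
  exists c : {ffun T -> transition} -> R,
    (forall del, 0 <= c del) /\
    (forall d, z d = \sum_(del | is_run del) c del * run_weight del d).
Proof.
have [n] := ubnP #|[pred d | z d != 0]|; elim: n z => // n IHn z.
rewrite ltnS => supp z_ge0 z_cons.
have [/existsP[d0 zd0]|/existsPn z0] := boolP [exists d, 0 < z d]; last first.
  exists (fun=> 0); split=> // d; rewrite big1 => [|del _]; last by rewrite mul0r.
  by apply/eqP; rewrite eq_le z_ge0 leNgt z0.
have [del0 run0 del0_gt0] := positive_run z_ge0 z_cons zd0.
(* [eps] is the smallest weight along the run: the largest multiple of the run that can be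
   subtracted while keeping [z'] nonnegative. *)
case: (@arg_minP _ _ _ (root T) xpredT (fun u => z (del0 u)) isT) => u0 _ u0_min.
set eps := z (del0 u0) in u0_min.
pose z' d := z d - eps * run_weight del0 d.
have z'_ge0 d : 0 <= z' d.
  rewrite /z' /run_weight subr_ge0; have [->|_] := eqVneq; last by rewrite mulr0.
  by rewrite mulr1 u0_min.
have z'_cons : conserved z'.
  move=> q qF; rewrite !sumrB -!mulr_sumr z_cons //.
  by rewrite (run_conserved run0).
have [|c [c_ge0 cE]] := IHn z' _ z'_ge0 z'_cons.
  (* Since [z'] lies between 0 and [z], no new support appears, and [del0 u0] drops out of it. *)
  apply: leq_trans supp; apply: proper_card; apply/properP; split.
    apply/subsetP=> d; rewrite !inE; apply: contraNneq => zd.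
    rewrite eq_le z'_ge0 andbT /z' zd sub0r oppr_le0 mulr_ge0 //.
    by rewrite ltW // del0_gt0.
  exists (del0 u0); rewrite !inE; first by rewrite gt_eqF ?del0_gt0.
  by rewrite negbK /z' /run_weight run_tag // eqxx mulr1 subrr.
exists (fun del => c del + (del == del0)%:R * eps); split=> [del|d].
  by rewrite addr_ge0 // mulr_ge0 // ltW // del0_gt0.
under eq_bigr do rewrite mulrDl.
rewrite big_split -cE /= (bigD1 del0) //= eqxx mul1r big1 ?addr0.
  by rewrite /z' subrK.
by move=> del /andP[_ /negbTE->]; rewrite !mul0r.
Qed.

(** * The linear system of flows *)

Definition equation : finType := ((T * Sigma) + (state A + unit))%type.

Definition eq_coef_orig (e : equation) (v : T * Sigma) : R :=
  if e is inl w then (v == w)%:R else 0.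

(** The three kinds of rows define the original variables, state conservation, and normalise the
    final weight. Final states get the trivial row 0 = 0, so that rows can be indexed by all
    states. *)
Definition eq_coef_ext (e : equation) (d : transition) : R :=
  match e with
  | inl w => - ((tag d == w.1) && (label d == w.2))%:R
  | inr (inl q) => if q \in final A then 0
                   else (target d == q)%:R - (q \in sources d)%:R
  | inr (inr _) => (target d \in final A)%:R
  end.

Definition eq_rhs (e : equation) : R := if e is inr (inr _) then 1 else 0.

Definition flow_system : linear_system R (T * Sigma)%type :=
  equation_system eq_coef_orig eq_coef_ext eq_rhs.

Definition is_flow (x : {ffun T * Sigma -> R}) z : Prop :=
  [/\ forall d, 0 <= z d, conserved z,
      \sum_(d | target d \in final A) z d = 1
    & forall v, x v = \sum_(d | (tag d == v.1) && (label d == v.2)) z d].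

Lemma sum_natb (P : pred transition) z :
  \sum_d (P d)%:R * z d = \sum_(d | P d) z d.
Proof.
by rewrite [RHS]big_mkcond; apply: eq_bigr => d _; case: (P d); rewrite ?mul1r ?mul0r.
Qed.

Lemma flow_systemP x (y : {ffun 'I_(nvar flow_system) -> R}) :
  solution x y <-> is_flow x (fun d => y (enum_rank d)).
Proof.
apply: (iff_trans (equation_systemP x y)).
set z := fun d => y (enum_rank d).
have labelE v :
    \sum_w eq_coef_orig (inl v) w * x w + \sum_d eq_coef_ext (inl v) d * z d
    = x v - \sum_(d | (tag d == v.1) && (label d == v.2)) z d.
  congr (_ + _).
    rewrite (bigD1 v) //= eqxx mul1r big1 ?addr0 // => w /negbTE->.
    by rewrite mul0r.
  by rewrite -[X in - X]sum_natb -sumrN; apply: eq_bigr => d _; rewrite /= mulNr.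
have origE e : \sum_w eq_coef_orig (inr e) w * x w = 0.
  by rewrite big1 // => w _; rewrite mul0r.
have consE q : q \notin final A ->
    \sum_d eq_coef_ext (inr (inl q)) d * z d
    = \sum_(d | target d == q) z d - \sum_(d | q \in sources d) z d.
  move=> /negbTE /= ->.
  rewrite -[X in _ = X - _]sum_natb -[X in _ = _ - X]sum_natb -sumrB.
  by apply: eq_bigr => d _; rewrite mulrBl.
split=> [[eqs z_ge0]|[z_ge0 z_cons z_fin xE]].
  split=> // [q qF||v].
  - have := eqs (inr (inl q)); rewrite origE add0r consE // => /eqP.
    by rewrite subr_eq0 => /eqP.
  - by have := eqs (inr (inr tt)); rewrite origE add0r sum_natb.
  - by have := eqs (inl v); rewrite labelE => /eqP; rewrite subr_eq0 => /eqP.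
split=> // -[v|[q|[]]].
- by rewrite labelE xE subrr.
- rewrite origE add0r; have [qF|qF] := boolP (q \in final A).
    by rewrite big1 // => d _; rewrite /= qF mul0r.
  by rewrite consE // z_cons // subrr.
- by rewrite origE add0r sum_natb.
Qed.

(** * The automaton polytope as the projection of the flows *)

Lemma flow_decomposition x z : is_flow x z ->
  exists c : {ffun T -> transition} -> R,
    [/\ forall del, 0 <= c del, \sum_(del | is_run del) c del = 1,
        forall d, z d = \sum_(del | is_run del) c del * run_weight del d
      & forall v, x v
          = \sum_(del | is_run del) c del * term_vector R (run_term del) v].
Proof.
case=> z_ge0 z_cons z_fin xE.
have [c [c_ge0 cE]] := conserved_decomposition z_ge0 z_cons.
(* Sums over sets of transitions are linear in [z], so they can be computed run by run: the final
   weight 1 of every run makes the coefficients sum to 1, and the label weights give term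
   vectors. *)
have sumE (P : pred transition) : \sum_(d | P d) z d
    = \sum_(del | is_run del) c del * \sum_(d | P d) run_weight del d.
  under eq_bigr do rewrite cE.
  by rewrite exchange_big; apply: eq_bigr => del _; rewrite mulr_sumr.
exists c; split=> // [|[u a]].
  rewrite -z_fin sumE; apply: eq_bigr => del run.
  by rewrite run_final_weight // mulr1.
by rewrite xE sumE; apply: eq_bigr => del run; rewrite run_label_weight.
Qed.

Lemma polytope_flow x :
  automaton_polytope A x -> exists z, is_flow x z.
Proof.
case=> n [p [c [pS c_ge0 c_sum xE]]].
(* The statement is put in boolean form so that [xchoose] can select one run for each point. *)
have del_ex i : exists del, is_run del && (p i == term_vector R (run_term del)).
  have [tau [/language_run[del run <-] ->]] := pS i.
  by exists del; rewrite run eqxx.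
pose del i := xchoose (del_ex i).
have run i : is_run (del i) by have /andP[] := xchooseP (del_ex i).
have pE i : p i = term_vector R (run_term (del i)).
  by have /andP[_ /eqP] := xchooseP (del_ex i).
have sumE (P : pred transition) :
    \sum_(d | P d) \sum_i c i * run_weight (del i) d
    = \sum_i c i * \sum_(d | P d) run_weight (del i) d.
  by rewrite exchange_big; apply: eq_bigr => i _; rewrite mulr_sumr.
exists (fun d => \sum_i c i * run_weight (del i) d); split=> [d|q qF||[u a]].
- by apply: sumr_ge0 => i _; rewrite mulr_ge0 // ler0n.
- by rewrite !sumE; apply: eq_bigr => i _; rewrite run_conserved.
- by rewrite sumE -c_sum; apply: eq_bigr => i _; rewrite run_final_weight ?mulr1.
- by rewrite xE sumE; apply: eq_bigr => i _; rewrite run_label_weight // pE.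
Qed.

Lemma flow_polytope x z : is_flow x z -> automaton_polytope A x.
Proof.
case/flow_decomposition=> c [c_ge0 c_sum _ xE].
exists #|is_run|, (fun i => term_vector R (run_term (enum_val i))),
  (fun i => c (enum_val i)); split=> // [i||v].
- exists (run_term (enum_val i)); split=> //.
  by apply: run_language; exact: (enum_valP i).
- by rewrite -(big_enum_val (A := is_run) c).
- by rewrite xE -(big_enum_val (A := is_run)
    (fun del => c del * term_vector R (run_term del) v)).
Qed.

(** Every coordinate is a convex combination of zeros and ones; this supplies the bound needed for
    the solution set to be a polytope. *)
Lemma flow_le1 x z : is_flow x z ->
  (forall v, `|x v| <= 1) /\ (forall d, `|z d| <= 1).
Proof.
case/flow_decomposition=> c [c_ge0 c_sum zE xE].
have avg_le1 (f : {ffun T -> transition} -> bool) :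
    `|\sum_(del | is_run del) c del * (f del)%:R| <= 1.
  rewrite ger0_norm; last by apply: sumr_ge0 => del _; rewrite mulr_ge0 ?ler0n.
  by rewrite -[leRHS]c_sum; apply: ler_sum => del _; case: (f del); rewrite ?mulr1 ?mulr0.
split=> [v|d]; last by rewrite zE avg_le1.
by rewrite xE; under eq_bigr do rewrite ffunE; rewrite avg_le1.
Qed.

Lemma flow_system_formulation :
  extended_formulation flow_system (@automaton_polytope R T Sigma A).
Proof.
split.
  exists 1 => x y /flow_systemP/flow_le1[x_le1 z_le1]; split=> // j.
  by have := z_le1 (enum_val j); rewrite enum_valK.
move=> x; split=> [/polytope_flow[z zx]|[y /flow_systemP]]; last exact: flow_polytope.
exists [ffun j => z (enum_val j)]; apply/flow_systemP.
have zE d : [ffun j => z (enum_val j)] (enum_rank d) = z d by rewrite ffunE enum_rankK.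
case: zx => z_ge0 z_cons z_fin xE.
split=> [d|q qF||v]; first by rewrite zE.
all: under eq_bigr do rewrite zE; try exact: z_fin; try exact: xE.
by under [RHS]eq_bigr do rewrite zE; exact: z_cons.
Qed.

(** * Size of the system *)

Lemma card_equation : #|equation| = (#|T| * #|Sigma| + (#|state A| + 1))%N.
Proof. by rewrite card_sum card_prod card_sum card_unit. Qed.

End Flow.

Theorem theorem4p1 :
  exists K : nat,
    forall (R : realFieldType) (T : addressed_tree) (Sigma : finType)
           (A : tree_automaton T Sigma),
      (0 < #|Sigma|)%N ->
      exists S : linear_system R (T * Sigma)%type,
        [/\ extended_formulation S (@automaton_polytope R T Sigma A),
            (nvar S <= K * (#|state A| + ntrans A))%N
          & (nineq S <= K * (#|state A| + #|T| * #|Sigma|))%N].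
Proof.
(* One factor 2 comes from splitting equations into inequalities; the other absorbs the
   normalisation row, as [#|T| * #|Sigma|] is at least 1. *)
exists 4 => R T Sigma A Sigma_gt0; exists (flow_system A R); split.
- exact: flow_system_formulation.
- rewrite /= card_transition; apply: leq_trans (leq_pmull _ _) => //.
  exact: leq_addl.
- rewrite /= card_prod card_bool card_equation.
  have TS_gt0 : (0 < #|T| * #|Sigma|)%N.
    by rewrite muln_gt0 Sigma_gt0 andbT; apply/card_gt0P; exists (root T).
  rewrite -[4]/(2 * 2)%N -mulnA leq_mul2l mul2n -addnn addnCA addnA leq_add2l.
  by rewrite addn_gt0 TS_gt0 orbT.
Qed.
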